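(* The non-classical permutation class $$\operatorname{Av}(2341, 3412, 3421,4123, 4231, 4312, 4\overline{1}352, 413\overline{5}2)$$ is Wilf equivalent to each of the classical permutation classes $$\operatorname{Av}(2431,3412,3421,4123,4213,4231,4312,4321),$$ $$\operatorname{Av}(2413,3412,3421,4123,4132,4213,4312,4321),$$ $$\operatorname{Av}(1342,1432,3142,3412,4123,4132,4213,4312).$$ That is, for every $n$, these four sets contain the same number of permutations of length $n$.
   Context: $\operatorname{Av}(\rho_1,\dots,\rho_m)$ denotes the set of all permutations (of all lengths) that avoid each of the patterns $\rho_1,\dots,\rho_m$. Classical patterns: a permutation $\pi$ of length $n$ contains $\rho\in\mathcal{S}_k$ if there are $1\le i_1<\cdots<i_k\le n$ such that $\pi_{i_a}<\pi_{i_b}$ if and only if $\rho_a<\rho_b$; such a subsequence is a copy of $\rho$. Otherwise $\pi$ avoids $\rho$. Barred patterns: a barred pattern is a permutation $\rho$ in which any entries may carry a bar. A permutation $\pi$ avoids the barred pattern $\rho$ if every copy in $\pi$ of the pattern formed by the non-barred entries of $\rho$ (order-isomorphic to those entries) extends to a copy of the full permutation formed by all entries of $\rho$, the given entries playing the roles of the non-barred entries. For example, $\pi$ avoids $4\overline{1}352$ if and only if every occurrence of $3241$ (the pattern of $4352$) in $\pi$ is the ''$4352$'' part of an occurrence of $41352$. Two sets of permutations are Wilf equivalent if, for every $n$, they contain the same number of permutations of length $n$. *)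

(* Defs.v *)
From mathcomp Require Import all_boot all_fingroup.

Set Implicit Arguments.
Unset Strict Implicit.
Unset Printing Implicit Defensive.

(* A permutation of length n is p : 'S_n, with positions and values in
   {0, ..., n-1}. Patterns are words in one-line notation with values in
   {1, ..., k}; only the relative order of their letters is used, so a word
   such as 4352, obtained by deleting letters from a permutation, needs no
   standardization. *)

Definition is_copy (n : nat) (p : 'S_n) (w : seq nat)
    (t : (size w).-tuple 'I_n) : bool :=
  sorted [rel i j : 'I_n | i < j] t &&
  [forall a : 'I_(size w), forall b : 'I_(size w),
     (p (tnth t a) < p (tnth t b)) == (nth 0 w a < nth 0 w b)].

Arguments is_copy {n} p w t.

Definition avoids (n : nat) (p : 'S_n) (w : seq nat) : bool :=
  ~~ [exists t : (size w).-tuple 'I_n, is_copy p w t].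

(* A letter is paired with true when it carries a bar. *)
Definition barred_pattern := seq (nat * bool).

Definition full_word (r : barred_pattern) : seq nat := [seq x.1 | x <- r].

Definition unbarred_mask (r : barred_pattern) : bitseq := [seq ~~ x.2 | x <- r].

Definition unbarred_word (r : barred_pattern) : seq nat :=
  mask (unbarred_mask r) (full_word r).

Definition avoids_barred (n : nat) (p : 'S_n) (r : barred_pattern) : bool :=
  [forall t : (size (unbarred_word r)).-tuple 'I_n,
     is_copy p (unbarred_word r) t ==>
     [exists u : (size (full_word r)).-tuple 'I_n,
        is_copy p (full_word r) u && (mask (unbarred_mask r) u == t :> seq 'I_n)]].

Definition perm_family := forall n : nat, {set 'S_n}.

(* The set of permutations avoiding all the classical patterns in ws and all
   the barred patterns in rs, graded by length. The lists are separate because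
   a pattern without bars read as a barred pattern would be avoided by every
   permutation. *)
Definition Av_mixed (ws : seq (seq nat)) (rs : seq barred_pattern) :
    perm_family :=
  fun n => [set p : 'S_n | all (avoids p) ws && all (avoids_barred p) rs].

Definition Av (ws : seq (seq nat)) : perm_family := Av_mixed ws [::].

Definition wilf_equivalent (A B : perm_family) : Prop :=
  forall n : nat, #|A n| = #|B n|.

(* Main.v *)
Require Import Defs.
From mathcomp Require Import all_boot all_fingroup zify.

Set Implicit Arguments.
Unset Strict Implicit.
Unset Printing Implicit Defensive.

(* Each of the four classes is closed under deleting the first letter, so its
   members are built by successively inserting letters in front of the empty
   word. The two barred patterns can be traded for patterns with an adjacency:
   given the classical patterns, avoiding 41352 with barred 1 (with barred 5)
   amounts to avoiding 3241 with adjacent first letters (4132 with adjacent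
   last letters). Then a letter x of a word q can often be deleted (and q
   standardized) without affecting the number of ways to extend q: this holds
   when one of the two sites next to x is dead, i.e. no letter can ever be
   inserted there, and prefixes with at most three letters do not distinguish q
   from q without x. These deletions leave finitely many states per class, and
   the multisets of states reached by n insertions satisfy the same linear
   recurrence, a(n+4) + a(n+2) + 2 a(n) = 3 a(n+3) + a(n+1), in all four
   classes. *)

(** * Vincular patterns and words with gaps *)

(* A letter paired with true must be adjacent to the preceding one. *)
Definition vincular_pattern := seq (nat * bool).

(* None is a gap, standing for an unspecified, possibly empty word: the letters
   on its two sides do not count as adjacent. *)
Definition marked_word := seq (option nat).

Definition same_order (x y : nat * nat) : bool :=
  if x.1 < y.1 then x.2 < y.2 else if y.1 < x.1 then y.2 < x.2 else x.2 == y.2.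

Definition order_iso (s w : seq nat) : bool :=
  (size s == size w) && pairwise same_order (zip s w).

(** A set flag forbids skipping before the next letter. A gap can be skipped but never selected,
    hence it breaks adjacency. *)
Fixpoint selections (fl : bitseq) (m : marked_word) : seq (seq nat) :=
  if fl is b :: fl' then
    if m is o :: m' then
      (if o is Some x then map (cons x) (selections fl' m') else [::]) ++
      (if b then [::] else selections fl m')
    else [::]
  else [:: [::]].

(* Spelled with conditionals rather than boolean connectives, so that its
   evaluation stops early. *)
Fixpoint fits (prev : seq (nat * nat)) (x : nat * nat) : bool :=
  if prev is y :: prev' then
    if same_order y x then fits prev' x else false
  else true.

Fixpoint occurs (prev : seq (nat * nat)) (w : vincular_pattern)
    (m : marked_word) : bool :=
  if w is ab :: w' then
    if m is o :: m' then
      if (if o is Some x then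
            if fits prev (x, ab.1) then occurs ((x, ab.1) :: prev) w' m'
            else false
          else false)
      then true else if ab.2 then false else occurs prev w m'
    else false
  else true.

Fixpoint contains (B : seq vincular_pattern) (m : marked_word) : bool :=
  if B is w :: B' then if occurs [::] w m then true else contains B' m
  else false.

Definition marked (s : seq nat) : marked_word := map Some s.

Definition rename (f : nat -> nat) (m : marked_word) : marked_word :=
  map (omap f) m.

Lemma selections0 m : selections [::] m = [:: [::]].
Proof. by case: m. Qed.

(** The backtracking search agrees with the exhaustive enumeration by [selections]. The accumulator
    [prev] holds the pairs matched so far, with which every new pair must be compatible. *)
Lemma occursE prev w m :
  occurs prev w m =
  has (fun s => order_iso s (unzip1 w) &&
         all (fits prev) (zip s (unzip1 w))) (selections (unzip2 w) m).
Proof.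
elim: m prev w => [|o m IHm] prev [|[a b] w] //=; rewrite has_cat.
set first := (X in if X then _ else _).
have -> : first = has (fun s => order_iso s (a :: unzip1 w) &&
    all (fits prev) (zip s (a :: unzip1 w)))
    (if o is Some x then map (cons x) (selections (unzip2 w) m) else [::]).
  rewrite /first; case: o {first} => // x; rewrite has_map.
  case: ifP => [px|px].
    rewrite IHm; apply: eq_has => s; rewrite /order_iso /= eqSS px /=.
    rewrite (eq_all (a2 := predI (same_order (x, a)) (fits prev))); last first.
      by move=> z /=; case: ifP.
    by rewrite all_predI; case: eqP => //= _; rewrite andbCA andbA.
  by symmetry; apply/hasPn => s _ /=; rewrite px andbF.
by case: b; rewrite /= ?orbF -?IHm; case: (has _ _).
Qed.

Lemma containsE B m :
  contains B m =
  has (fun w => has (order_iso^~ (unzip1 w)) (selections (unzip2 w) m)) B.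
Proof.
elim: B => //= w B ->; rewrite occursE.
rewrite (eq_has (a2 := order_iso^~ (unzip1 w))); last first.
  by move=> s; rewrite (eq_all (a2 := xpredT)) ?all_predT ?andbT.
by case: (has _ _).
Qed.

Lemma containsP B m :
  reflect (exists w s, [/\ w \in B, s \in selections (unzip2 w) m
                         & order_iso s (unzip1 w)])
          (contains B m).
Proof.
rewrite containsE; apply: (iffP hasP) => [[w wB /hasP[s sm ws]]|].
  by exists w, s.
by case=> w [s [wB sm ws]]; exists w => //; apply/hasP; exists s.
Qed.

Lemma selections_rename f fl m :
  selections fl (rename f m) = map (map f) (selections fl m).
Proof.
elim: m fl => [|o m IHm] [|b fl] //=; rewrite !IHm map_cat.
by case: o b => [x|] [] //=; rewrite -!map_comp.
Qed.

Lemma mem_selections fl m s x :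
  s \in selections fl m -> x \in s -> Some x \in m.
Proof.
elim: m fl s => [|o m IHm] [|b fl] s //=; rewrite ?inE; try by move/eqP->.
rewrite mem_cat => /orP[].
  case: o => // y /mapP[s' s'm ->]; rewrite !inE => /orP[/eqP->|xs'].
    by rewrite eqxx.
  by rewrite (IHm _ _ s'm xs') orbT.
by case: b => // sm xs; rewrite (IHm _ _ sm xs) orbT.
Qed.

Lemma order_iso_map f s w :
  {in s &, {mono f : x y / x < y}} -> order_iso (map f s) w = order_iso s w.
Proof.
move=> fM; rewrite /order_iso size_map; case: eqP => //= szs.
have -> : zip (map f s) w = [seq (f x.1, x.2) | x <- zip s w].
  by elim: s w {fM szs} => [|x s IHs] [|a w] //=; rewrite IHs.
rewrite pairwise_map; apply: eq_in_pairwise (allss _) => -[x a] [y b] /=.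
move=> /(map_f fst) + /(map_f fst); rewrite -/(unzip1 _) unzip1_zip ?szs //.
by move=> xs ys; rewrite /same_order /= !fM.
Qed.

Lemma contains_rename B f m :
  (forall x y, Some x \in m -> Some y \in m -> (f x < f y) = (x < y)) ->
  contains B (rename f m) = contains B m.
Proof.
move=> fM; rewrite !containsE; apply: eq_has => w.
rewrite selections_rename has_map.
apply: eq_in_has => s sm /=; apply: order_iso_map => x y xs ys.
by apply: fM; apply: mem_selections sm _.
Qed.

(* The gaps of the first word stand for factors of the second one. *)
Inductive shrinks : marked_word -> marked_word -> Prop :=
| shrinks_nil : shrinks [::] [::]
| shrinks_cons o v m : shrinks v m -> shrinks (o :: v) (o :: m)
| shrinks_gap v m : shrinks v m -> shrinks (None :: v) m
| shrinks_skip o v m : shrinks (None :: v) m -> shrinks (None :: v) (o :: m).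

Lemma shrinks_refl m : shrinks m m.
Proof. by elim: m => [|o m IHm]; constructor. Qed.

Lemma shrinks_catr v m q : shrinks v m -> shrinks (v ++ q) (m ++ q).
Proof.
elim=> {v m} [|o v m _ IH|v m _ IH|o v m _ IH] /=; try by constructor.
exact: shrinks_refl.
Qed.

(** A gap is crossed only before a letter without flag, and such a letter may as well cross the
    whole factor that the gap stands for. *)
Lemma selections_shrinks fl v m :
  shrinks v m -> {subset selections fl v <= selections fl m}.
Proof.
move=> vm; elim: vm fl => {v m} [|o v m _ IH|v m _ IH|o v m _ IH] fl s //.
- case: fl => [|b fl] //=; rewrite !mem_cat => /orP[|].
    case: o => // x /mapP[s' /IH s'm ->].
    by rewrite map_f.
  by case: b => // /IH ->; rewrite orbT.
- case: fl => [|[] fl] //=; first by rewrite !selections0.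
  exact: IH.
- case: fl => [|b fl] //= sv; rewrite mem_cat.
  by case: b sv => // /(IH (false :: fl))->; rewrite orbT.
Qed.

Lemma contains_shrinks B v m : shrinks v m -> contains B v -> contains B m.
Proof.
move=> vm /containsP[w [s [wB sv ws]]]; apply/containsP; exists w, s.
by split=> //; apply: selections_shrinks sv.
Qed.

(** A flag on the first letter would anchor copies at the beginning of the word, and a prefix could
    then destroy them. *)
Definition floating (w : vincular_pattern) : bool := ~~ head false (unzip2 w).

Lemma contains_catl B l m :
  all floating B -> contains B m -> contains B (l ++ m).
Proof.
move=> /allP flB /containsP[w [s [wB sm ws]]]; apply/containsP; exists w, s.
split=> //; move/flB: wB; rewrite /floating.
case: (unzip2 w) sm => [|[] fl] //= sm _; first by rewrite !selections0 in sm *.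
by elim: l => //= o l IHl; rewrite mem_cat IHl orbT.
Qed.

Lemma contains_gap B m :
  all floating B -> contains B (None :: m) = contains B m.
Proof.
rewrite !containsE => /allP flB; apply: eq_in_has => w /flB; rewrite /floating.
by case: (unzip2 w) => [|[] fl] //= _; rewrite selections0.
Qed.

Lemma selections_catr fl m q :
  {subset selections fl m <= selections fl (m ++ q)}.
Proof.
elim: m fl => [|o m IHm] [|b fl] s //=; first by rewrite selections0.
rewrite !mem_cat => /orP[|]; last by case: b => // /IHm->; rewrite orbT.
by case: o => // x /mapP[s' /IHm s'm ->]; rewrite map_f.
Qed.

(** Encodes the letters of a prefix used by a copy; the boolean records whether letters are dropped
    just after. *)
Definition gapped (u : seq (nat * bool)) : marked_word :=
  flatten [seq Some x.1 :: nseq (nat_of_bool x.2) None | x <- u].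

(** The letters picked in the prefix are kept and those passed over become gaps. If the selection
    does not end inside the prefix, at least one of its letters lies in [q], whence the strict bound
    on [size u']. *)
Lemma selections_cat fl u q s :
    s \in selections fl (marked u ++ q) ->
  s \in selections fl (marked u) \/
  exists (g : bool) u',
    [/\ shrinks (nseq g None ++ gapped u') (marked u),
        s \in selections fl (nseq g None ++ gapped u' ++ q),
        size u' < size fl & subseq (unzip1 u') u].
Proof.
elim: u fl s => [|y u IHu] [|b fl] s /=.
- by rewrite selections0; left.
- by move=> sq; right; exists false, [::]; split=> //; apply: shrinks_nil.
- by left.
rewrite !mem_cat => /orP[/mapP[s' s'uq ->]|].
  have [s'u|[g [u' [sh s'u' szu' subu']]]] := IHu _ _ s'uq.
    by left; rewrite map_f.
  right; exists false, ((y, g) :: u') => /=; split=> //.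
  - exact: shrinks_cons.
  - by rewrite -catA mem_cat map_f.
  - by rewrite eqxx.
case: b => // suq.
have [su|[g [u' [sh su' szu' subu']]]] := IHu (false :: fl) _ suq.
  by left; rewrite su orbT.
(* The skipped letter [y] is absorbed by a gap in front, which is created if there was none. *)
right; exists true, u' => /=; split=> //.
- apply: shrinks_skip; case: g sh {su'} => // sh; exact: shrinks_gap.
- by case: g su' {sh}.
- exact: subseq_trans (subseq_cons _ _).
Qed.

Definition short_patterns (B : seq vincular_pattern) : bool :=
  all (fun w => size w <= 4) B.

(** Prefixes of arbitrary length thus reduce to gapped words with at most three letters, a finite
    supply up to order isomorphism. *)
Lemma contains_cat B u q1 q2 :
    all floating B -> short_patterns B ->
    (forall u', subseq (unzip1 u') u -> size u' < 4 ->
       contains B (gapped u' ++ q1) -> contains B (gapped u' ++ q2)) ->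
  contains B (marked u ++ q1) -> contains B (marked u ++ q2).
Proof.
move=> flB /allP szB H /containsP[w [s [wB sq1 ws]]].
have [su|[g [u' [sh su' szu' subu']]]] := selections_cat sq1.
  by apply/containsP; exists w, s; split=> //; apply: selections_catr.
apply: (@contains_shrinks _ ((nseq g None ++ gapped u') ++ q2)).
  exact: shrinks_catr.
rewrite -catA; apply: contains_catl => //; apply: H => //.
  by apply: leq_trans szu' _; rewrite size_map szB.
have : contains B (nseq g None ++ gapped u' ++ q1).
  by apply/containsP; exists w, s.
by case: g {sh su'} => //=; rewrite contains_gap.
Qed.

(** * Value maps and insertion sites *)

(** Here [f] gives the current values of the letters [0], ..., [n-1] of a standardized word inside a
    longer one. *)
Definition increasing n (f : nat -> nat) : Prop :=
  forall x y, x < y < n -> f x < f y.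

(* y lies between the images of the letters d-1 and d. *)
Definition in_site n (f : nat -> nat) d y : Prop :=
  forall x, x < n -> if x < d then f x < y else y < f x.

Definition insert_letter j (s : seq nat) : seq nat := j :: map (bump j) s.

Lemma increasing_mono n f x y :
  increasing n f -> x < n -> y < n -> (f x < f y) = (x < y).
Proof.
move=> fI xn yn; case: (ltngtP x y) => [xy|yx|->]; last exact: ltnn.
  by apply: fI; rewrite xy.
by apply/negbTE; rewrite -leqNgt ltnW // fI // yx.
Qed.

Lemma site_exists n f y :
    increasing n f -> (forall x, x < n -> f x <> y) ->
  exists2 j, j <= n & in_site n f j y.
Proof.
elim: n => [|n IHn] fI fy; first by exists 0.
have [||j jn jy] := IHn.
- by move=> a b /andP[ab bn]; rewrite fI // ab ltnW.
- by move=> x xn; apply: fy; rewrite ltnW.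
case: (ltngtP (f n) y) => [fny|yfn|]; last by move/fy => [].
- exists n.+1 => // x; rewrite ltnS => xn; rewrite xn.
  move: xn; rewrite leq_eqVlt => /orP[/eqP->//|xn].
  by apply: ltn_trans fny; rewrite fI // xn /=.
- exists j => [|x]; first exact: ltnW.
  rewrite ltnS leq_eqVlt => /orP[/eqP->|/jy//].
  by rewrite ltnNge jn.
Qed.

(** The value map once a letter [j] of value [y] has joined the word, the older letters being
    renumbered by [bump j]. *)
Definition extend_at j y (f : nat -> nat) (x : nat) : nat :=
  if x == j then y else f (unbump j x).

Lemma extend_atE j y f : extend_at j y f j = y.
Proof. by rewrite /extend_at eqxx. Qed.

Lemma extend_at_bump j y f x : extend_at j y f (bump j x) = f x.
Proof.
by rewrite /extend_at eq_sym (negbTE (neq_bump _ _)) bumpK.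
Qed.

Lemma extend_at_increasing n j y f :
    increasing n f -> j <= n -> in_site n f j y ->
  increasing n.+1 (extend_at j y f).
Proof.
move=> fI jn jy a b /andP[ab bn]; rewrite /extend_at.
case: (eqVneq a j) => [aj|aj]; case: (eqVneq b j) => [bj|bj].
- lia.
- have -> : unbump j b = b.-1 by rewrite /unbump; lia.
  have /jy : b.-1 < n by lia.
  by case: ltnP => //; lia.
- have -> : unbump j a = a by rewrite /unbump; lia.
  have /jy : a < n by lia.
  by case: ltnP => //; lia.
- by apply: fI; rewrite /unbump; lia.
Qed.

Lemma ltn_bump2 j x y : (bump j x < bump j y) = (x < y).
Proof. rewrite /bump; lia. Qed.

Lemma increasing_bump n j f :
  j <= n -> increasing n.+1 f -> increasing n (f \o bump j).
Proof.
by move=> jn fI x y /andP[xy yn] /=; apply: fI; rewrite ltn_bump2 xy /bump; lia.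
Qed.

Lemma in_site_bump n j d f y :
    j <= n -> in_site n.+1 f (bump j d) y -> in_site n (f \o bump j) d y.
Proof.
move=> jn yd x xn /=; rewrite -(ltn_bump2 j); apply: yd.
by rewrite /bump; lia.
Qed.

(** The new letter falls into a site other than [d], so it does not split the range of values of
    that site. *)
Lemma in_site_unbump n j d f y :
    j <= n -> d <= n -> j != d -> increasing n.+1 f ->
  in_site n (f \o bump j) d y -> in_site n.+1 f (bump j d) y.
Proof.
move=> jn dn jd fI yd x xn; have [->|xj] := eqVneq x j; last first.
  rewrite -(unbumpK xj) ltn_bump2; apply: yd.
  by move: xj; rewrite /unbump; lia.
have [jd'|dj] := ltnP j d.
  have -> : j < bump j d by rewrite /bump; lia.
  have /yd : j < n by lia.
  rewrite jd' /=; apply: ltn_trans; apply: fI; rewrite /bump; lia.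
have -> : (j < bump j d) = false by rewrite /bump; lia.
have /yd : j.-1 < n by lia.
rewrite /= ifN; last by lia.
by move/ltn_trans; apply; apply: fI; rewrite /bump; lia.
Qed.

Lemma notin_site_bump n j d f :
    j <= n -> d <= n -> j != d -> increasing n.+1 f ->
  ~ in_site n (f \o bump j) d (f j).
Proof.
move=> jn dn jd fI jnd; have [jd'|dj] := ltnP j d.
  have /jnd : j < n by lia.
  by rewrite jd' /= ltnNge ltnW // fI // /bump; lia.
have /jnd : j.-1 < n by lia.
rewrite /= ifN; last by lia.
by rewrite ltnNge ltnW // fI // /bump; lia.
Qed.

(** * Interchangeable words and dead sites *)

(** The word [u] consists of the letters inserted in front. Those falling into site [d] are excluded
    because the site will be dead. *)
Definition interchangeable B n d (q1 q2 : seq nat) : Prop :=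
  forall f u, increasing n f -> uniq u ->
    (forall x y, x < n -> y \in u -> f x <> y) ->
    (forall y, y \in u -> ~ in_site n f d y) ->
  contains B (marked (u ++ map f q1)) = contains B (marked (u ++ map f q2)).

(** The gap leaves room for letters inserted earlier than [y], so the site remains forbidden at
    every later stage. *)
Definition dead B n d (q : seq nat) : Prop :=
  forall f y, increasing n f -> in_site n f d y ->
  contains B (Some y :: None :: marked (map f q)).

(** The inserted letter is reread as the last letter of the prefix [u]. *)
Lemma interchangeable_insert B n d j q1 q2 :
    j <= n -> d <= n -> j != d -> interchangeable B n d q1 q2 ->
  interchangeable B n.+1 (bump j d) (insert_letter j q1) (insert_letter j q2).
Proof.
move=> jn dn jd q12 f u fI uU uf ud /=; rewrite -!map_comp -!cat_rcons.
apply: q12 => [||x y xn|y].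
- exact: increasing_bump.
- rewrite rcons_uniq uU andbT; apply/negP => /(uf j (f j)); apply=> //.
- rewrite mem_rcons inE => /orP[/eqP-> /=|]; last first.
    by apply: uf; rewrite /bump; lia.
  have jx : bump j x <> j by rewrite /bump; lia.
  move=> fxj; apply: jx; have [xj|jx|//] := ltngtP (bump j x) j.
  + have : f (bump j x) < f j by apply: fI; rewrite xj.
    by rewrite fxj ltnn.
  + have : f j < f (bump j x) by apply: fI; rewrite jx /bump; lia.
    by rewrite fxj ltnn.
- rewrite mem_rcons inE => /orP[/eqP->|yu]; first exact: notin_site_bump.
  by move=> yd; apply: (ud y) => //; apply: in_site_unbump.
Qed.

(** The gap after [y] absorbs the inserted letter. *)
Lemma dead_insert B n d j q :
  j <= n -> dead B n d q -> dead B n.+1 (bump j d) (insert_letter j q).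
Proof.
move=> jn qd f y fI yd; have := qd (f \o bump j) y.
rewrite /= -map_comp => /(_ (increasing_bump jn fI) (in_site_bump jn yd)).
apply: contains_shrinks; apply: shrinks_cons; do 2 ! apply: shrinks_skip.
exact/shrinks_gap/shrinks_refl.
Qed.

(** * Counting extensions and deleting letters *)

Fixpoint num_extensions B k (q : seq nat) : nat :=
  if k is k'.+1 then
    \sum_(j < (size q).+1) num_extensions B k' (insert_letter j q)
  else ~~ contains B (marked q).

Definition letters_below n (m : marked_word) : Prop :=
  forall x, Some x \in m -> x < n.

Lemma rename_marked f q : rename f (marked q) = marked (map f q).
Proof. by rewrite /rename /marked -!map_comp. Qed.

Lemma contains_insert B j q :
    all floating B -> contains B (marked q) ->
  contains B (marked (insert_letter j q)).
Proof.
move=> flB qB; rewrite /= -rename_marked -cat1s; apply: contains_catl => //.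
by rewrite contains_rename // => x y _ _; apply: ltn_bump2.
Qed.

Lemma num_extensions_contains B k q :
  all floating B -> contains B (marked q) -> num_extensions B k q = 0.
Proof.
move=> flB; elim: k q => [|k IHk] q qB /=; first by rewrite qB.
by rewrite big1 // => j _; apply: IHk; apply: contains_insert.
Qed.

Lemma increasing_bump_id n j : increasing n (bump j).
Proof. by move=> x y /andP[xy _]; rewrite ltn_bump2. Qed.

Lemma num_extensions_dead B k d q :
    all floating B -> dead B (size q) d q ->
  num_extensions B k (insert_letter d q) = 0.
Proof.
move=> flB qd; apply: num_extensions_contains => //=.
apply: (@contains_shrinks _ (Some d :: None :: marked (map (bump d) q))).
  by do 2 ! constructor; apply: shrinks_refl.
apply: qd; first exact: increasing_bump_id.
by move=> x _; rewrite /bump; case: ltnP; lia.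
Qed.

(** Site [i] of the word without [x] is site [bump d i] of the word with [x]. Inserting a letter
    there and restoring [x] commute. *)
Lemma bump_exchange x d i z :
    (d == x) || (d == x.+1) ->
  bump (bump d i) (bump x z) = bump (bump (bump d i) x) (bump i z).
Proof. by rewrite /bump; lia. Qed.

(* The sites d = x and d = x.+1 are those immediately below and above the
   deleted letter x; one of them being dead, the others correspond to the sites
   of q'. *)
Lemma num_extensions_delete B k (x d : nat) q q' :
    all floating B -> size q = (size q').+1 -> x <= size q' ->
    (d == x) || (d == x.+1) -> letters_below (size q') (marked q') ->
    interchangeable B (size q) d q (map (bump x) q') -> dead B (size q) d q ->
  num_extensions B k q = num_extensions B k q'.
Proof.
move=> flB; elim: k x d q q' => [|k IHk] x d q q' szq xq' dx q'lt qq' qd.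
  (* No insertion is left: the two words are compared with unchanged values and an empty prefix. *)
  have := qq' id [::]; rewrite !map_id /= => -> //; first last.
    by move=> y z /andP[].
  rewrite -rename_marked contains_rename // => y z _ _.
  exact: ltn_bump2.
have dq : d < (size q).+1 by lia.
rewrite /= (bigD1_ord (P := xpredT) (Ordinal dq)) //=.
rewrite num_extensions_dead // add0n szq.
apply: eq_bigr => i _; pose j := bump d i.
have jd : j != d by rewrite eq_sym neq_bump.
have jq : j <= size q by rewrite szq /j /bump; have := ltn_ord i; lia.
apply: (IHk (bump j x) (bump j d)).
- by rewrite /= !size_map szq.
- by rewrite /= size_map /bump; lia.
- by move: dx; rewrite /j /bump; lia.
- rewrite /= size_map => y; rewrite inE => /orP[/eqP[->]|].
    exact: ltn_ord.
  rewrite -rename_marked => /mapP[[z|] //] /q'lt zq' [->].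
  by rewrite /bump; lia.
- have -> : map (bump (bump j x)) (insert_letter i q')
          = insert_letter j (map (bump x) q').
    rewrite /insert_letter /= -!map_comp; congr cons.
      by move: dx; rewrite /j /bump; lia.
    by apply: eq_map => z /=; rewrite (bump_exchange _ _ dx).
  by rewrite /= size_map; apply: interchangeable_insert.
- by rewrite /= size_map; apply: dead_insert.
Qed.

(** * A bounded test of interchangeability *)

(** The prefix is explored from its last letter backwards. When both words contain a pattern the
    branch is closed, since every extension of them does too. *)
Fixpoint agree B k (n d : nat) (m1 m2 : marked_word) : bool :=
  if contains B m1 then contains B m2 else
  if contains B m2 then false else
  if k is k'.+1 then
    all (fun j => if j == d then true else
           let m1' := rename (bump j) m1 in
           let m2' := rename (bump j) m2 in
           agree B k' n.+1 (bump j d) (Some j :: m1') (Some j :: m2') &&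
           agree B k' n.+1 (bump j d)
             (Some j :: None :: m1') (Some j :: None :: m2'))
        (iota 0 n.+1)
  else true.

Lemma agree_contains B k n d m1 m2 :
  agree B k n d m1 m2 -> contains B m1 = contains B m2.
Proof. by case: k => [|k] /=; case: ifP => // _; case: ifP. Qed.

Lemma letters_below_rename n j m :
  letters_below n m -> letters_below n.+1 (rename (bump j) m).
Proof.
by move=> mn x /mapP[[y|] // /mn yn [->]]; rewrite /bump; lia.
Qed.

Lemma contains_rename_increasing B n f m :
    increasing n f -> letters_below n m ->
  contains B (rename f m) = contains B m.
Proof.
move=> fI mn; apply: contains_rename => x y /mn xn /mn yn.
exact: increasing_mono fI _ _.
Qed.

Lemma rename_extend_at j y f m :
  rename (extend_at j y f) (rename (bump j) m) = rename f m.
Proof.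
rewrite /rename -map_comp; apply: eq_map => -[x|] //=.
by rewrite extend_at_bump.
Qed.

Lemma gapped_rcons u y (g : bool) :
  gapped (rcons u (y, g)) = gapped u ++ Some y :: nseq g None.
Proof. by rewrite /gapped map_rcons flatten_rcons. Qed.

(** The last letter [y] of the prefix differs from all values of [f], hence lies in some site [j],
    and [j] is not [d]. Moving [y] into both words, with value map [extend_at j y f], shortens the
    prefix. *)
Lemma agree_gapped B k n d m1 m2 f u :
    all floating B -> agree B k n d m1 m2 -> d <= n ->
    letters_below n m1 -> letters_below n m2 ->
    increasing n f -> size u <= k -> uniq (unzip1 u) ->
    (forall x y, x < n -> y \in unzip1 u -> f x <> y) ->
    (forall y, y \in unzip1 u -> ~ in_site n f d y) ->
  contains B (gapped u ++ rename f m1) = contains B (gapped u ++ rename f m2).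
Proof.
move=> flB; elim: k n d m1 m2 f u => [|k IHk] n d m1 m2 f u m12 dn m1n m2n fI.
  case: u => // _ _ _ _.
  by rewrite !(contains_rename_increasing _ fI) ?(agree_contains m12).
have m12B := agree_contains m12.
have [m1B|m1B] := boolP (contains B m1).
  move=> _ _ _ _; rewrite !contains_catl //.
    by rewrite (contains_rename_increasing _ fI) // -m12B.
  by rewrite (contains_rename_increasing _ fI).
move/negbTE in m1B.
case/lastP: u => [|u [y g]].
  by rewrite !(contains_rename_increasing _ fI) ?(agree_contains m12).
rewrite size_rcons ltnS {1 2 3}/unzip1 map_rcons rcons_uniq => szu.
move=> /andP[/= yu uU] uf ud.
have yu' : y \in rcons (unzip1 u) y by rewrite mem_rcons mem_head.
have [j jn jy] := site_exists fI (fun x xn => uf x y xn yu').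
have jd : j != d by apply/eqP => jd; apply: (ud y yu'); rewrite -jd.
pose f' := extend_at j y f.
pose m' m := Some j :: nseq g None ++ rename (bump j) m.
have f'm m : rename f' (m' m) = Some y :: nseq g None ++ rename f m.
  rewrite /m' /f' /= extend_atE; congr cons.
  by rewrite {1}/rename map_cat map_nseq [map _ (rename _ _)]rename_extend_at.
have m'n m : letters_below n m -> letters_below n.+1 (m' m).
  move=> mn x; rewrite inE => /orP[/eqP[->]//|].
  rewrite mem_cat mem_nseq andbF => /orP[//|]; exact: letters_below_rename.
rewrite gapped_rcons -!catA !cat_cons -!f'm.
have f'I : increasing n.+1 f' by apply: extend_at_increasing.
apply: (IHk n.+1 (bump j d)) => //.
(* The test at site [j] covers the new letter with and without a gap after it; [g] selects the
   case. *)
- move: m12; cbn [agree]; rewrite m1B -m12B m1B => /allP/(_ j).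
  rewrite mem_iota /= ltnS jn => /(_ isT).
  by rewrite /m' (negbTE jd) /= => /andP[]; case: (g).
- by rewrite /bump; lia.
- exact: m'n.
- exact: m'n.
- move=> x z xn zu; have [->|xj] := eqVneq x j.
    by rewrite /f' extend_atE => yz; rewrite yz zu in yu.
  rewrite -(unbumpK xj) /f' extend_at_bump; apply: uf.
    by move: xj; rewrite /unbump; lia.
  by rewrite mem_rcons inE zu orbT.
- move=> z zu /(in_site_bump jn) zd; apply: (ud z).
    by rewrite mem_rcons inE zu orbT.
  by move=> x /zd; rewrite /= /f' extend_at_bump.
Qed.

(* Three letters suffice: a copy of a pattern of length at most 4 that is not
   contained in the prefix u has at most three letters in u. *)
Lemma agree_interchangeable B n d q1 q2 :
    all floating B -> short_patterns B -> d <= n ->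
    letters_below n (marked q1) -> letters_below n (marked q2) ->
    agree B 3 n d (marked q1) (marked q2) ->
  interchangeable B n d q1 q2.
Proof.
move=> flB szB dn q1n q2n q12 f u fI uU uf ud.
rewrite /marked !map_cat -!/(marked _).
have agr u' : subseq (unzip1 u') u -> size u' < 4 ->
    contains B (gapped u' ++ marked (map f q1)) =
    contains B (gapped u' ++ marked (map f q2)).
  move=> u'u szu'; rewrite -!rename_marked.
  apply: (agree_gapped flB q12) => //.
  - exact: subseq_uniq u'u uU.
  - by move=> x y xn /(mem_subseq u'u); apply: uf.
  - by move=> y /(mem_subseq u'u); apply: ud.
by apply/idP/idP; apply: contains_cat => // u' u'u szu'; rewrite agr.
Qed.

(** One standardized instance suffices: every other one is its image under the increasing map
    [extend_at d y f]. *)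
Lemma contains_dead B n d q :
    d <= n -> letters_below n (marked q) ->
    contains B (Some d :: None :: marked (map (bump d) q)) ->
  dead B n d q.
Proof.
move=> dn qn qB f y fI yd; rewrite -rename_marked -(rename_extend_at d y).
have f'I : increasing n.+1 (extend_at d y f) by apply: extend_at_increasing.
have <- : rename (extend_at d y f)
            (Some d :: None :: rename (bump d) (marked q)) =
          Some y :: None ::
            rename (extend_at d y f) (rename (bump d) (marked q)).
  by rewrite /= extend_atE.
rewrite (contains_rename_increasing _ f'I) ?rename_marked // => x.
rewrite !inE => /or3P[/eqP[->]//|//|].
rewrite -rename_marked; exact: letters_below_rename.
Qed.

(** * Certified deletions *)

(* The entry (q, x, above) claims that deleting the letter x from q does not
   affect the extensions of q, the site just above (or just below) x being
   dead. *)
Definition deletion := (seq nat * nat * bool)%type.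

Definition delete_letter (x : nat) (q : seq nat) : seq nat :=
  map (unbump x) (rem x q).

(** The boolean [above] is added as 0 or 1, the sites just below and just above [x] being numbered
    [x] and [x.+1]. *)
Definition valid_deletion B (e : deletion) : bool :=
  let: (q, x, above) := e in
  let n := size q in
  let d := above + x in
  let q' := delete_letter x q in
  [&& n == (size q').+1, x < n, all (gtn n) q, all (gtn n.-1) q',
      contains B (Some d :: None :: marked (map (bump d) q))
    & agree B 3 n d (marked q) (marked (map (bump x) q'))].

Definition reduce_step (D : seq deletion) (q : seq nat) : seq nat :=
  if [seq e <- D | e.1.1 == q] is e :: _ then delete_letter e.1.2 q else q.

(** A valid deletion removes one letter, so [size q] rounds reach an irreducible word. *)
Definition reduce D (q : seq nat) : seq nat := iter (size q) (reduce_step D) q.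

Lemma letters_below_marked n q :
  all (gtn n) q -> letters_below n (marked q).
Proof. by move=> /allP qn x /mapP[y /qn yn [->]]. Qed.

Lemma num_extensions_delete_letter B k q x above :
    all floating B -> short_patterns B -> valid_deletion B (q, x, above) ->
  num_extensions B k (delete_letter x q) = num_extensions B k q.
Proof.
move=> flB szB /and5P[/eqP szq xq qn q'n /andP[qd agr]].
have dn : above + x <= size q by case: (above); lia.
have q'n' : letters_below (size (delete_letter x q))
                          (marked (delete_letter x q)).
  by rewrite szq in q'n; apply: letters_below_marked.
symmetry; apply: (@num_extensions_delete B k x (above + x)) => //.
- by rewrite -ltnS -szq.
- by case: (above); rewrite eqxx ?orbT.
- apply: agree_interchangeable => //; first exact: letters_below_marked.
  by rewrite -rename_marked szq; apply: letters_below_rename.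
- by apply: contains_dead => //; apply: letters_below_marked.
Qed.

Lemma num_extensions_reduce B D k q :
    all floating B -> short_patterns B -> all (valid_deletion B) D ->
  num_extensions B k (reduce D q) = num_extensions B k q.
Proof.
move=> flB szB /allP vD; rewrite /reduce; elim: (size q) => //= n <-.
move: (iter _ _ _) => {n}q; rewrite /reduce_step.
case Dq : (filter _ _) => [//|e D'].
have : e \in [seq e <- D | e.1.1 == q] by rewrite Dq mem_head.
rewrite mem_filter => /andP[/eqP <- /vD]; case: e {Dq} => -[p x] above /=.
exact: num_extensions_delete_letter.
Qed.

(** * Generations of states and the linear recurrence *)

Definition children B D (q : seq nat) : seq (seq nat) :=
  [seq reduce D c | c <- [seq insert_letter j q | j <- iota 0 (size q).+1]
                  & ~~ contains B (marked c)].

Lemma num_extensions_children B D k q :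
    all floating B -> short_patterns B -> all (valid_deletion B) D ->
  num_extensions B k.+1 q = \sum_(c <- children B D q) num_extensions B k c.
Proof.
move=> flB szB vD; rewrite /children big_map big_filter big_map.
have -> : iota 0 (size q).+1 = index_iota 0 (size q).+1.
  by rewrite /index_iota subn0.
rewrite big_mkord [RHS]big_mkcond [LHS]/=.
apply: eq_bigr => j _; rewrite num_extensions_reduce //.
by case: ifPn => // /negPn qB; rewrite num_extensions_contains.
Qed.

(** Repetitions are kept, because the counts are sums over this multiset. *)
Definition generation B D n : seq (seq nat) :=
  iter n (fun s => flatten (map (children B D) s)) [:: [::]].

Lemma num_extensions_generation B D n k :
    all floating B -> short_patterns B -> all (valid_deletion B) D ->
  num_extensions B (k + n) [::] =
  \sum_(q <- generation B D n) num_extensions B k q.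
Proof.
move=> flB szB vD; elim: n k => [|n IHn] k.
  by rewrite addn0 /generation /= big_seq1.
rewrite addnS -addSn IHn /= big_flatten big_map.
by apply: eq_bigr => q _; apply: num_extensions_children.
Qed.

(* The last test is the recurrence a(n+4) + a(n+2) + 2 a(n) = 3 a(n+3) + a(n+1)
   with n = 3, for multisets of states. The numbers of words satisfy the shorter
   a(n+3) = 2 a(n+2) + a(n+1) + 2 a(n), but the multisets of states of the
   barred class do not. *)
Definition certified B D : bool :=
  let g := generation B D in
  [&& all floating B, short_patterns B, all (valid_deletion B) D,
      [seq count (fun q => ~~ contains B (marked q)) (g n) | n <- iota 0 7]
        == [:: 1; 1; 2; 6; 16; 42; 112]
    & perm_eq (g 7 ++ g 5 ++ g 3 ++ g 3)
              (g 6 ++ g 6 ++ g 6 ++ g 4)].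

(** Summing [num_extensions B k] over both sides of the multiset identity gives the recurrence for
    every [k]. With the seven common initial values it determines the whole sequence. *)
Lemma certified_num_extensions B1 D1 B2 D2 n :
    certified B1 D1 -> certified B2 D2 ->
  num_extensions B1 n [::] = num_extensions B2 n [::].
Proof.
have init B D m : certified B D -> m < 7 ->
    num_extensions B m [::] = nth 0 [:: 1; 1; 2; 6; 16; 42; 112] m.
  move=> /and5P[flB szB vD /eqP <- _] m7.
  rewrite (nth_map 0) ?size_iota // nth_iota // add0n -[m in LHS]add0n.
  rewrite (num_extensions_generation _ _ flB szB vD) -sum1_count.
  by rewrite [RHS]big_mkcond; apply: eq_bigr => q _ /=; case: contains.
have rec B D k : certified B D ->
    num_extensions B (k + 7) [::] + num_extensions B (k + 5) [::] +
      2 * num_extensions B (k + 3) [::] =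
    3 * num_extensions B (k + 6) [::] + num_extensions B (k + 4) [::].
  move=> /and5P[flB szB vD _ g].
  rewrite !(num_extensions_generation _ _ flB szB vD).
  have := perm_big _ g (op := addn) (x := 0) (P := xpredT)
            (F := num_extensions B k).
  by rewrite !big_cat /=; lia.
move=> c1 c2; have [m] := ubnP n; elim: m n => // m IHm n nm.
have [n7|n7] := ltnP n 7; first by rewrite (init _ _ _ c1) // (init _ _ _ c2).
have := rec _ _ (n - 7) c1; have := rec _ _ (n - 7) c2.
rewrite subnK //; rewrite !(IHm (n - 7 + _)); lia.
Qed.

(** * Permutations as words built by insertion *)

Definition word n (p : 'S_n) : seq nat := [seq val (p i) | i <- enum 'I_n].

Lemma word_lift_perm n (j : 'I_n.+1) (p : 'S_n) :
  word (lift_perm ord0 j p) = insert_letter j (word p).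
Proof.
rewrite /word /insert_letter enum_ordSl /= lift_perm_id -!map_comp; congr cons.
by apply: eq_map => i /=; rewrite lift_perm_lift.
Qed.

Lemma uniq_word n (p : 'S_n) : uniq (word p).
Proof.
rewrite map_inj_uniq ?enum_uniq // => i j /val_inj; exact: perm_inj.
Qed.

(** A permutation is determined by its first letter and the standardization of the rest; injectivity
    is enough, both sides having [(n+1)!] elements. *)
Lemma sum_lift_perm n (h : 'S_n.+1 -> nat) :
  \sum_p h p = \sum_(p : 'S_n) \sum_j h (lift_perm ord0 j p).
Proof.
rewrite pair_big /=.
rewrite (reindex (fun x : 'S_n * 'I_n.+1 => lift_perm ord0 x.2 x.1)) //.
apply/onW_bij/inj_card_bij => [[p i] [q j] /= pq|].
  have ij : i = j by have := congr1 (fun s : 'S_n.+1 => s ord0) pq;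
                     rewrite /= !lift_perm_id.
  congr pair => //; apply/permP => k.
  have := congr1 (fun s : 'S_n.+1 => s (lift ord0 k)) pq.
  by rewrite /= !lift_perm_lift ij => /lift_inj.
by rewrite card_prod card_ord !card_Sn factS mulnC.
Qed.

(** Each step trades a pending insertion for a letter of the permutation. The equation [n + k = m]
    avoids casts between permutation types. *)
Lemma sum_num_extensions B k n m :
    n + k = m ->
  \sum_(p : 'S_n) num_extensions B k (word p) =
  \sum_(p : 'S_m) num_extensions B 0 (word p).
Proof.
elim: k n => [|k IHk] n; first by rewrite addn0 => <-.
rewrite addnS -addSn => nm.
rewrite -(IHk n.+1) // sum_lift_perm; apply: eq_bigr => p _ /=.
rewrite size_map size_enum_ord; apply: eq_bigr => j _.
by rewrite word_lift_perm.
Qed.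

Lemma card_avoiders B n :
  #|[set p : 'S_n | ~~ contains B (marked (word p))]| = num_extensions B n [::].
Proof.
rewrite -sum1dep_card big_mkcond /=.
transitivity (\sum_(p : 'S_n) num_extensions B 0 (word p)).
  by apply: eq_bigr => p _ /=; case: contains.
(* Everything starts from ['S_0], whose single element has the empty word. *)
rewrite -(@sum_num_extensions B n 0) //.
rewrite (eq_bigr (fun=> num_extensions B n [::])).
  by rewrite sum_nat_const card_Sn mul1n.
move=> p _; congr num_extensions; apply: size0nil.
by rewrite size_map size_enum_ord.
Qed.

(** * Copies of patterns as subsequences of words *)

Lemma same_orderE x y :
  same_order x y =
  ((x.1 < y.1) == (x.2 < y.2)) && ((y.1 < x.1) == (y.2 < x.2)).
Proof.
by rewrite /same_order; case: (ltngtP x.1); case: (ltngtP x.2).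
Qed.

Lemma order_isoP s w :
  reflect (size s = size w /\ forall i j, i < size w -> j < size w ->
             (nth 0 s i < nth 0 s j) = (nth 0 w i < nth 0 w j))
          (order_iso s w).
Proof.
apply: (iffP andP) => -[+ sw] => [/eqP|] sz; split; rewrite ?sz //.
  move=> i j iw jw; have {}sw := pairwiseP (0, 0) sw.
  rewrite size_zip sz minnn in sw.
  have [ij|ji|->] := ltngtP i j; last by rewrite !ltnn.
    have := sw i j iw jw ij; rewrite !nth_zip // same_orderE /=.
    by case/andP => /eqP.
  have := sw j i jw iw ji; rewrite !nth_zip // same_orderE /=.
  by case/andP => _ /eqP.
apply/(pairwiseP (0, 0)) => i j; rewrite !inE size_zip sz minnn => iw jw _.
by rewrite !nth_zip // same_orderE /= !sw ?eqxx.
Qed.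

(** A strictly increasing sequence of positions is the enumeration filtered by membership in it. *)
Lemma sorted_ord_subseq n (t : seq 'I_n) :
  sorted [rel i j : 'I_n | i < j] t = subseq t (enum 'I_n).
Proof.
have tr : transitive [rel i j : 'I_n | i < j].
  by move=> j i k /=; apply: ltn_trans.
have enum_sorted : sorted [rel i j : 'I_n | i < j] (enum 'I_n).
  by have := iota_ltn_sorted 0 n; rewrite -val_enum_ord sorted_map.
apply/idP/idP => [ts|/subseq_sorted]; last exact.
have -> : t = [seq i <- enum 'I_n | i \in t].
  apply: (irr_sorted_eq tr) => //= [i||i]; first exact: ltnn.
  - exact: sorted_filter.
  - by rewrite mem_filter mem_enum andbT.
exact: filter_subseq.
Qed.

Definition letters n (p : 'S_n) (t : seq 'I_n) : seq nat :=
  [seq val (p i) | i <- t].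

Lemma letters_inj n (p : 'S_n) : injective (letters p).
Proof. by apply: inj_map => i j /val_inj; apply: perm_inj. Qed.

Lemma is_copyE n (p : 'S_n) w (t : (size w).-tuple 'I_n) :
  is_copy p w t = subseq t (enum 'I_n) && order_iso (letters p t) w.
Proof.
rewrite /is_copy sorted_ord_subseq; congr andb.
apply/idP/idP.
  move=> /forallP H; apply/order_isoP; rewrite size_map size_tuple; split=> //.
  move=> i j iw jw; have /forallP/(_ (Ordinal jw))/eqP := H (Ordinal iw).
  have x0 := tnth t (Ordinal iw).
  by rewrite !(nth_map x0) ?size_tuple // !(tnth_nth x0).
move=> /order_isoP[_ H]; apply/forallP => i; apply/forallP => j; apply/eqP.
rewrite -H // !(nth_map (tnth t i)) ?size_tuple //.
by rewrite -!tnth_nth.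
Qed.

Lemma subseq_word n (p : 'S_n) s :
  subseq s (word p) -> exists2 t, s = letters p t & subseq t (enum 'I_n).
Proof.
case/subseqP => m _ ->; exists (mask m (enum 'I_n)); first by rewrite -map_mask.
exact: mask_subseq.
Qed.

Lemma avoidsP n (p : 'S_n) w :
  reflect (forall s, subseq s (word p) -> ~~ order_iso s w) (avoids p w).
Proof.
apply: (iffP existsPn) => H; last first.
  by move=> t; rewrite is_copyE; apply/nandP; case: (boolP (subseq t _));
     [move=> /(map_subseq (fun i => val (p i)))/H; right | left].
move=> s /subseq_word[t -> tn]; apply/negP => tw.
have sz : size t == size w.
  by case/order_isoP: tw => <- _; rewrite size_map.
by have := H (Tuple sz); rewrite is_copyE tn tw.
Qed.

Lemma avoids_barredP n (p : 'S_n) r :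
  reflect (forall s, subseq s (word p) -> order_iso s (unbarred_word r) ->
             exists u, [/\ subseq u (word p), order_iso u (full_word r)
                         & mask (unbarred_mask r) u = s])
          (avoids_barred p r).
Proof.
apply: (iffP forallP) => H.
  move=> s /subseq_word[t -> tn] tr.
  have sz : size t == size (unbarred_word r).
    by case/order_isoP: tr => <- _; rewrite size_map.
  have := H (Tuple sz); rewrite is_copyE tn tr => /existsP[u /andP[]].
  rewrite is_copyE => /andP[un ur] /eqP ut; exists (letters p u); split=> //.
    exact: map_subseq.
  by rewrite -map_mask ut.
move=> t; apply/implyP; rewrite is_copyE => /andP[tn tr].
have [|_ [/subseq_word[u -> un] ur ut]] := H (letters p t) _ tr.
  exact: map_subseq.
have sz : size u == size (full_word r).
  by case/order_isoP: ur => <- _; rewrite size_map.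
apply/existsP; exists (Tuple sz); rewrite is_copyE un ur /=.
(* Letters of a permutation determine their positions. *)
by apply/eqP/(@letters_inj _ p); rewrite /letters map_mask.
Qed.

Definition classical (w : seq nat) : vincular_pattern :=
  [seq (x, false) | x <- w].

Lemma selections_marked b fl u s :
  s \in selections (b :: fl) (marked u) <->
  exists l x r s', [/\ u = l ++ x :: r, b -> l = [::], s = x :: s'
                     & s' \in selections fl (marked r)].
Proof.
split.
  elim: u => //= y u IHu; rewrite mem_cat => /orP[/mapP[s' s'u ->]|].
    by exists [::], y, u, s'.
  case: b IHu => // IHu /IHu[l [x [r [s' [-> _ -> s'r]]]]].
  by exists (y :: l), x, r, s'.
move=> [l [x [r [s' [-> bl -> s'r]]]]]; case: b bl => [->|_] //=.
  by rewrite mem_cat map_f.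
elim: l => [|y l IHl] /=; first by rewrite mem_cat map_f.
by rewrite mem_cat IHl orbT.
Qed.

Lemma selections_subseq k u s :
  (s \in selections (nseq k false) (marked u)) = (size s == k) && subseq s u.
Proof.
apply/idP/andP.
  elim: k u s => [|k IHk] u s.
    by rewrite selections0 inE => /eqP->; rewrite sub0seq.
  move/selections_marked => [l [x [r [s' [-> _ -> /IHk[/eqP <- s'r]]]]]].
  split=> //; rewrite -[x :: s']cat0s; apply: cat_subseq; first exact: sub0seq.
  by rewrite /= eqxx.
move=> [/eqP <- {k}]; elim: s u => [|x s IHs] u; first by rewrite selections0.
elim: u => //= y u IHu; rewrite mem_cat.
case: eqP => [->|_ xsu]; first by move=> /IHs su; rewrite map_f.
by rewrite IHu // orbT.
Qed.

Lemma contains1 w m :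
  contains [:: w] m =
  has (order_iso^~ (unzip1 w)) (selections (unzip2 w) m).
Proof. by rewrite containsE /= orbF. Qed.

Lemma avoids_contains n (p : 'S_n) w :
  avoids p w = ~~ contains [:: classical w] (marked (word p)).
Proof.
have w2 : unzip2 (classical w) = nseq (size w) false.
  by elim: w => //= x w ->.
have w1 : unzip1 (classical w) = w by rewrite /unzip1 -map_comp map_id.
rewrite contains1 w1 w2.
apply/avoidsP/hasPn => H s; last first.
  move=> sp; apply/negP => sw; have := H s.
  rewrite selections_subseq sp sw andbT; case/order_isoP: sw => -> _.
  by rewrite eqxx => /(_ isT).
by rewrite selections_subseq => /andP[_ /H].
Qed.

Lemma containsN_cons w B m :
  ~~ contains (w :: B) m = ~~ contains [:: w] m && ~~ contains B m.
Proof. by rewrite /=; case: occurs. Qed.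

Lemma containsN_all B m :
  ~~ contains B m = all (fun w => ~~ contains [:: w] m) B.
Proof. by elim: B => // w B IHB; rewrite containsN_cons IHB. Qed.

(** * Trading barred patterns for vincular ones *)

Lemma subseq_uniq_tail (T : eqType) (l r s : seq T) x :
  uniq (l ++ x :: r) -> subseq (x :: s) (l ++ x :: r) -> subseq s r.
Proof.
elim: l => [|y l IHl] /=; first by rewrite eqxx.
move=> /andP[yl lU]; rewrite ifN; first exact: IHl.
by apply: contra yl => /eqP<-; rewrite mem_cat mem_head orbT.
Qed.

(** A letter between [x] and [y] would force a second occurrence of [y], inside [r]. *)
Lemma subseq_adjacent (T : eqType) (l r s : seq T) x e y :
  uniq (l ++ x :: y :: r) -> ~~ subseq (x :: e :: y :: s) (l ++ x :: y :: r).
Proof.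
move=> lU; apply/negP => /(subseq_uniq_tail lU) eys.
move: lU; rewrite cat_uniq /= => /and4P[_ _ _ /andP[yr _]].
case/negP: yr; move: eys => /=.
case: eqP => [_ /mem_subseq/(_ y)|_ /mem_subseq/(_ y)].
  by rewrite mem_head => /(_ isT).
by rewrite !inE eqxx orbT => /(_ isT).
Qed.

Lemma subseq_cons_split (T : eqType) (x : T) s u :
  subseq (x :: s) u -> exists l r, u = l ++ x :: r /\ subseq s r.
Proof.
elim: u => //= y u IHu; case: eqP => [-> su|_ /IHu[l [r [-> sr]]]].
  by exists [::], u.
by exists (y :: l), r.
Qed.

Lemma subseq_cat_cons (T : eqType) (x : T) s l r :
  subseq s r -> subseq (x :: s) (l ++ x :: r).
Proof.
move=> sr; rewrite -[x :: s]cat0s; apply: cat_subseq; first exact: sub0seq.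
by rewrite /= eqxx.
Qed.

Definition barred_41352_1 : barred_pattern :=
  [:: (4, false); (1, true); (3, false); (5, false); (2, false)].

Definition barred_41352_5 : barred_pattern :=
  [:: (4, false); (1, false); (3, false); (5, true); (2, false)].

Lemma iso_4352 a b c d :
  order_iso [:: a; b; c; d] [:: 4; 3; 5; 2] = (d < b < a) && (a < c).
Proof.
apply/order_isoP/idP => [[_ H]|H].
  have /= -> := H 3 1 isT isT; have /= -> := H 1 0 isT isT.
  by have /= -> := H 0 2 isT isT.
by split=> // -[|[|[|[|i]]]] [|[|[|[|j]]]] //= _ _; lia.
Qed.

Lemma iso_4132 a b c d :
  order_iso [:: a; b; c; d] [:: 4; 1; 3; 2] = (b < d < c) && (c < a).
Proof.
apply/order_isoP/idP => [[_ H]|H].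
  have /= -> := H 1 3 isT isT; have /= -> := H 3 2 isT isT.
  by have /= -> := H 2 0 isT isT.
by split=> // -[|[|[|[|i]]]] [|[|[|[|j]]]] //= _ _; lia.
Qed.

Lemma iso_4231 a b c d :
  d < b < c -> c < a -> order_iso [:: a; b; c; d] [:: 4; 2; 3; 1].
Proof.
move=> H1 H2; apply/order_isoP.
by split=> // -[|[|[|[|i]]]] [|[|[|[|j]]]] //= _ _; lia.
Qed.

Lemma iso_4312 a b c d :
  c < d < b -> b < a -> order_iso [:: a; b; c; d] [:: 4; 3; 1; 2].
Proof.
move=> H1 H2; apply/order_isoP.
by split=> // -[|[|[|[|i]]]] [|[|[|[|j]]]] //= _ _; lia.
Qed.

Lemma iso_41352 a e b c d :
  e < d -> d < b < a -> a < c ->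
  order_iso [:: a; e; b; c; d] [:: 4; 1; 3; 5; 2].
Proof.
move=> H1 H2 H3; apply/order_isoP.
by split=> // -[|[|[|[|[|i]]]]] [|[|[|[|[|j]]]]] //= _ _; lia.
Qed.

Definition vincular_4352 : vincular_pattern :=
  [:: (4, false); (3, true); (5, false); (2, false)].

Definition vincular_4132 : vincular_pattern :=
  [:: (4, false); (1, false); (3, false); (2, true)].

Lemma contains_vincular_4352 u :
  contains [:: vincular_4352] (marked u) <->
  exists l a b r c d, [/\ u = l ++ a :: b :: r, subseq [:: c; d] r
                        & (d < b < a) && (a < c)].
Proof.
rewrite contains1; split=> [/hasP[s]|[l [a [b [r [c [d [-> cdr abcd]]]]]]]].
  move/selections_marked => [l [a [r [s1 [-> _ ->]]]]].
  move/selections_marked => [l' [b [r' [s2 [-> /(_ isT)-> ->]]]]].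
  rewrite -[selections _ _]/(selections (nseq 2 false) (marked r')).
  rewrite selections_subseq; case: s2 => [|c [|d [|? ?]]] //= cdr.
  by rewrite iso_4352 => abcd; exists l, a, b, r', c, d.
apply/hasP; exists [:: a; b; c; d]; last by rewrite iso_4352.
apply/selections_marked; exists l, a, (b :: r), [:: b; c; d]; split=> //.
apply/selections_marked; exists [::], b, r, [:: c; d]; split=> //.
rewrite -[selections _ _]/(selections (nseq 2 false) (marked r)).
by rewrite selections_subseq.
Qed.

Lemma contains_vincular_4132 u :
  contains [:: vincular_4132] (marked u) <->
  exists l a b c d r, [/\ u = l ++ c :: d :: r, subseq [:: a; b] l
                        & (b < d < c) && (c < a)].
Proof.
rewrite contains1; split=> [/hasP[s]|[l [a [b [c [d [r [-> abl abcd]]]]]]]].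
  move/selections_marked => [l1 [a [r1 [s1 [-> _ ->]]]]].
  move/selections_marked => [l2 [b [r2 [s2 [-> _ ->]]]]].
  move/selections_marked => [l3 [c [r3 [s3 [-> _ ->]]]]].
  move/selections_marked => [l4 [d [r [s4 [-> /(_ isT)-> ->]]]]].
  rewrite selections0 inE => /eqP-> /=; rewrite iso_4132 => abcd.
  exists (l1 ++ a :: l2 ++ b :: l3), a, b, c, d, r; split=> //.
    by rewrite -!(catA, cat_cons).
  by do 2 ! apply: subseq_cat_cons; apply: sub0seq.
case/subseq_cons_split: abl => l1 [l2 [-> /subseq_cons_split[l3 [l4 [-> _]]]]].
apply/hasP; exists [:: a; b; c; d]; last by rewrite iso_4132.
rewrite -!(catA, cat_cons).
apply/selections_marked; do 4 ! eexists; split=> //.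
apply/selections_marked; do 4 ! eexists; split=> //.
apply/selections_marked; do 4 ! eexists; split=> //.
apply/selections_marked; exists [::], d, r, [::]; split=> //.
by rewrite selections0.
Qed.

(** For [u] the word of a permutation this is barred avoidance, by [avoids_barredP]. *)
Definition extends_copies u (r : barred_pattern) : Prop :=
  forall s, subseq s u -> order_iso s (unbarred_word r) ->
  exists v, [/\ subseq v u, order_iso v (full_word r)
              & mask (unbarred_mask r) v = s].

Lemma order_iso_size s w : order_iso s w -> size s = size w.
Proof. by case/andP => /eqP. Qed.

(* If the 4 and the 3 of a copy of 4352 are not adjacent and nothing below the
   2 lies between them, the letter following the 4 starts a shorter copy,
   forms a copy of the vincular pattern with the 4, or forms a copy of 4231. *)
Lemma vincular_4352_barred u :
    uniq u ->
    (forall s, subseq s u -> ~~ order_iso s [:: 4; 2; 3; 1]) ->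
  extends_copies u barred_41352_1 <-> ~~ contains [:: vincular_4352] (marked u).
Proof.
move=> uU av; split=> [ext|vinc].
  apply/negP => /contains_vincular_4352[l [a [b [r [c [d [uE cdr abcd]]]]]]].
  have su : subseq [:: a; b; c; d] u.
    rewrite uE; apply: subseq_cat_cons; by rewrite /= eqxx.
  (* The extended copy would have a letter between the adjacent [a] and [b]. *)
  have [|v [vu /order_iso_size]] := ext _ su; first by rewrite iso_4352.
  case: v vu => [|a' [|e [|b' [|c' [|d' [|? ?]]]]]] //= vu _ [? ? ? ?]; subst.
  by case/negP: (subseq_adjacent [:: c; d] e uU).
move=> s + sr; have := order_iso_size sr.
case: s sr => [|a [|b [|c [|d [|? ?]]]]] //; rewrite iso_4352 => abcd _.
case/subseq_cons_split => l [r0 [uE /subseq_cons_split[m [r [r0E cdr]]]]].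
have {r0 r0E} uE : u = l ++ a :: m ++ b :: r by rewrite uE r0E.
have [e em ed] : exists2 e, e \in m & e < d.
  (* Both [l] and [a] vary, since passing to the shorter copy moves [a] into the prefix. *)
  elim: m l a uE abcd => [|x m IHm] l a uE abcd.
    case/negP: vinc; apply/contains_vincular_4352.
    by exists l, a, b, r, c, d.
  have [xd|dx] := ltnP x d; first by exists x; rewrite ?mem_head.
  have cr : c \in r by apply: (mem_subseq cdr); rewrite mem_head.
  have dr : d \in r by apply: (mem_subseq cdr); rewrite !inE eqxx orbT.
  move: (uU); rewrite uE cat_uniq => /and3P[_ _].
  rewrite !cons_uniq => /and3P[+ + _]; rewrite inE negb_or => /andP[ax _] xm.
  have xc : x != c.
    by apply: contraNneq xm => ->; rewrite mem_cat inE cr !orbT.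
  have {}xd : x != d.
    by apply: contraNneq xm => ->; rewrite mem_cat inE dr !orbT.
  have cdm : subseq [:: c; d] (m ++ b :: r).
    apply: subseq_trans cdr _; apply: subseq_trans (suffix_subseq _ _).
    exact: subseq_cons.
  have [xa|ax'] := ltnP x a.
    case/negP: vinc; apply/contains_vincular_4352.
    by exists l, a, x, (m ++ b :: r), c, d; split=> //; lia.
  have [xc'|cx] := ltnP x c.
    have [||e em ed] := IHm (rcons l a) x; first by rewrite cat_rcons.
      lia.
    by exists e; rewrite // inE em orbT.
  have /av/negP[] : subseq [:: x; b; c; d] u; last by apply: iso_4231; lia.
  by rewrite uE -cat_rcons; do 2 ! apply: subseq_cat_cons.
exists [:: a; e; b; c; d]; split=> //; last by apply: iso_41352; lia.
rewrite uE; apply: subseq_cat_cons; rewrite -cat1s.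
by apply: cat_subseq; [rewrite sub1seq | rewrite /= eqxx].
Qed.

(* Dually, the letter preceding the 2 of a copy of 4132 ends a shorter copy,
   forms a copy of the vincular pattern with the 2, or forms a copy of 4312. *)
Lemma vincular_4132_barred u :
    uniq u ->
    (forall s, subseq s u -> ~~ order_iso s [:: 4; 3; 1; 2]) ->
  extends_copies u barred_41352_5 <-> ~~ contains [:: vincular_4132] (marked u).
Proof.
move=> uU av; split=> [ext|vinc].
  apply/negP => /contains_vincular_4132[l [a [b [c [d [r [uE abl abcd]]]]]]].
  have su : subseq [:: a; b; c; d] u.
    rewrite uE -[[:: a; b; c; d]]/([:: a; b] ++ [:: c; d]).
    by apply: cat_subseq => //; rewrite /= eqxx /= eqxx sub0seq.
  have [|v [vu /order_iso_size]] := ext _ su; first by rewrite iso_4132.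
  case: v vu => [|a' [|b' [|c' [|e [|d' [|? ?]]]]]] //= vu _ [? ? ? ?]; subst.
  case/negP: (subseq_adjacent [::] e uU); apply: subseq_trans vu.
  by rewrite -[X in subseq _ X]/([:: a; b] ++ [:: c; e; d]) suffix_subseq.
move=> s + sr; have := order_iso_size sr.
case: s sr => [|a [|b [|c [|d [|? ?]]]]] //; rewrite iso_4132 => abcd _ abcdu.
have [l [m [r [uE abl]]]] :
    exists l m r, u = l ++ c :: m ++ d :: r /\ subseq [:: a; b] l.
  case/subseq_cons_split: abcdu => l1 [r1 [-> /subseq_cons_split]].
  case=> l2 [r2 [-> /subseq_cons_split[l3 [r3 [-> /subseq_cons_split]]]]].
  case=> m [r [-> _]]; exists (l1 ++ a :: l2 ++ b :: l3), m, r.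
  rewrite -!(catA, cat_cons); split=> //.
  by do 2 ! apply: subseq_cat_cons; apply: sub0seq.
clear abcdu; have [e em ae] : exists2 e, e \in m & a < e.
  (* The induction runs from the right, as the shorter copy ends at the last letter of the
     factor. *)
  elim/last_ind: m d r uE abcd => [|m x IHm] d r uE abcd.
    case/negP: vinc; apply/contains_vincular_4132.
    by exists l, a, b, c, d, r.
  have [ax|xa] := ltnP a x; first by exists x; rewrite ?mem_rcons ?mem_head.
  have [al bl] : a \in l /\ b \in l.
    by split; apply: (mem_subseq abl); rewrite !inE eqxx ?orbT.
  have uE' : u = (l ++ c :: m) ++ x :: d :: r.
    by rewrite uE cat_rcons -catA.
  move: (uU); rewrite uE' cat_uniq => /and3P[_ /hasPn xl].
  rewrite cons_uniq inE negb_or => /andP[/andP[xd _] _].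
  have {}xl : x \notin l ++ c :: m by apply: xl; rewrite mem_head.
  have xneq y : y \in l ++ c :: m -> x != y.
    by move=> yl; apply: contraNneq xl => ->.
  have {xneq} [xa' xb xc] : [/\ x != a, x != b & x != c].
    by split; apply: xneq; rewrite mem_cat ?al ?bl // mem_head orbT.
  have abm : subseq [:: a; b] (l ++ c :: m).
    exact: subseq_trans abl (prefix_subseq _ _).
  have [dx|xd'] := ltnP d x.
    case/negP: vinc; apply/contains_vincular_4132.
    by exists (l ++ c :: m), a, b, x, d, r; split=> //; lia.
  have [bx|xb'] := ltnP b x.
    have [||e em ae] := IHm x (d :: r); first by rewrite uE cat_rcons.
      lia.
    by exists e; rewrite // mem_rcons inE em orbT.
  have /av/negP[] : subseq [:: a; c; x; d] u; last by apply: iso_4312; lia.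
  rewrite uE' -[[:: a; c; x; d]]/([:: a; c] ++ [:: x; d]) cat_subseq //.
    rewrite -[[:: a; c]]/([:: a] ++ [:: c]) cat_subseq ?sub1seq //.
    by rewrite mem_head.
  by rewrite /= eqxx /= eqxx sub0seq.
exists [:: a; b; c; e; d]; split=> //; last by apply: iso_41352; lia.
rewrite uE -[[:: a; b; c; e; d]]/([:: a; b] ++ c :: [:: e] ++ [:: d]).
rewrite cat_subseq //= eqxx -[[:: e; d]]/([:: e] ++ [:: d]).
rewrite cat_subseq ?sub1seq //.
by rewrite mem_head.
Qed.

(** * Cardinalities of the classes *)

Lemma containsN_classical ws n (p : 'S_n) :
  ~~ contains (map classical ws) (marked (word p)) = all (avoids p) ws.
Proof.
rewrite containsN_all all_map; apply: eq_all => w /=.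
by rewrite avoids_contains.
Qed.

Lemma card_Av ws n :
  #|Av ws n| = num_extensions (map classical ws) n [::].
Proof.
rewrite -card_avoiders; apply: eq_card => p.
by rewrite !inE andbT containsN_classical.
Qed.

Lemma card_Av_mixed ws n :
    [:: 4; 2; 3; 1] \in ws -> [:: 4; 3; 1; 2] \in ws ->
  #|Av_mixed ws [:: barred_41352_1; barred_41352_5] n| =
  num_extensions [:: vincular_4352, vincular_4132 & map classical ws] n [::].
Proof.
move=> ws1 ws2; rewrite -card_avoiders; apply: eq_card => p.
rewrite !inE containsN_cons (containsN_cons vincular_4132) containsN_classical.
rewrite andbC [RHS]andbA.
(* The trade is valid only in the presence of 4231 and 4312, so the classical patterns are assumed
   avoided first; otherwise both sides are false. *)
case: (boolP (all _ ws)) => [av|]; last by rewrite !andbF.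
have avw w : w \in ws -> forall s, subseq s (word p) -> ~~ order_iso s w.
  by move=> wws; apply/avoidsP/(allP av).
have E1 := vincular_4352_barred (uniq_word p) (avw _ ws1).
have E2 := vincular_4132_barred (uniq_word p) (avw _ ws2).
rewrite /= !andbT; congr andb.
- by apply/avoids_barredP/idP => /E1.
- by apply/avoids_barredP/idP => /E2.
Qed.

Lemma certified_wilf_equivalent ws1 ws2 D1 D2 :
    certified [:: vincular_4352, vincular_4132 & map classical ws1] D1 ->
    certified (map classical ws2) D2 ->
    [:: 4; 2; 3; 1] \in ws1 -> [:: 4; 3; 1; 2] \in ws1 ->
  wilf_equivalent (Av_mixed ws1 [:: barred_41352_1; barred_41352_5]) (Av ws2).
Proof.
move=> c1 c2 ws1_1 ws1_2 n; rewrite card_Av_mixed // card_Av.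
exact: certified_num_extensions c1 c2.
Qed.

(** * Certificates for the four classes *)

Definition barred_class_words : seq (seq nat) :=
  [:: [:: 2; 3; 4; 1]; [:: 3; 4; 1; 2]; [:: 3; 4; 2; 1];
      [:: 4; 1; 2; 3]; [:: 4; 2; 3; 1]; [:: 4; 3; 1; 2]].

Definition barred_class_deletions : seq deletion :=
  [:: ([:: 0; 1; 2], 2, true); ([:: 0; 2; 1], 2, true);
      ([:: 2; 1; 0], 2, false); ([:: 0; 2; 1; 3], 2, true);
      ([:: 0; 2; 3; 1], 2, false); ([:: 0; 3; 1; 2], 3, false);
      ([:: 1; 2; 0; 3], 3, false); ([:: 1; 3; 0; 2], 2, true);
      ([:: 2; 1; 0; 3], 2, false); ([:: 3; 1; 0; 2], 1, true)].

Lemma barred_class_words_certified :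
  certified [:: vincular_4352, vincular_4132 & map classical barred_class_words]
    barred_class_deletions.
(* The computation runs [agree] on every listed deletion, then builds the generations up to the
   seventh. *)
Proof. by vm_compute. Qed.

Definition classical_words1 : seq (seq nat) :=
  [:: [:: 2; 4; 3; 1]; [:: 3; 4; 1; 2]; [:: 3; 4; 2; 1]; [:: 4; 1; 2; 3];
      [:: 4; 2; 1; 3]; [:: 4; 2; 3; 1]; [:: 4; 3; 1; 2]; [:: 4; 3; 2; 1]].

Definition classical_deletions1 : seq deletion :=
  [:: ([:: 0; 1; 2], 2, true); ([:: 1; 0; 2], 2, true);
      ([:: 1; 2; 0], 2, true); ([:: 0; 1; 3; 2], 3, false);
      ([:: 0; 3; 1; 2], 3, false); ([:: 1; 0; 3; 2], 3, false);
      ([:: 1; 3; 0; 2], 3, false); ([:: 2; 0; 3; 1], 3, false);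
      ([:: 3; 0; 2; 1], 2, false); ([:: 0; 1; 4; 3; 2], 4, false);
      ([:: 1; 0; 4; 3; 2], 4, false)].

Lemma classical_words1_certified :
  certified (map classical classical_words1) classical_deletions1.
Proof. by vm_compute. Qed.

Definition classical_words2 : seq (seq nat) :=
  [:: [:: 2; 4; 1; 3]; [:: 3; 4; 1; 2]; [:: 3; 4; 2; 1]; [:: 4; 1; 2; 3];
      [:: 4; 1; 3; 2]; [:: 4; 2; 1; 3]; [:: 4; 3; 1; 2]; [:: 4; 3; 2; 1]].

Definition classical_deletions2 : seq deletion :=
  [:: ([:: 0; 1; 2], 2, true); ([:: 0; 2; 1], 2, true);
      ([:: 1; 0; 2], 2, true); ([:: 0; 1; 2; 3], 2, true);
      ([:: 0; 2; 3; 1], 2, true); ([:: 0; 3; 2; 1], 3, false);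
      ([:: 1; 0; 2; 3], 2, true); ([:: 1; 2; 3; 0], 3, true);
      ([:: 2; 1; 3; 0], 3, false); ([:: 3; 1; 2; 0], 1, true);
      ([:: 0; 1; 4; 2; 3], 4, false); ([:: 0; 2; 4; 3; 1], 2, true);
      ([:: 1; 0; 4; 2; 3], 4, false); ([:: 1; 2; 4; 3; 0], 4, false);
      ([:: 2; 1; 4; 3; 0], 4, false)].

Lemma classical_words2_certified :
  certified (map classical classical_words2) classical_deletions2.
Proof. by vm_compute. Qed.

Definition classical_words3 : seq (seq nat) :=
  [:: [:: 1; 3; 4; 2]; [:: 1; 4; 3; 2]; [:: 3; 1; 4; 2]; [:: 3; 4; 1; 2];
      [:: 4; 1; 2; 3]; [:: 4; 1; 3; 2]; [:: 4; 2; 1; 3]; [:: 4; 3; 1; 2]].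

Definition classical_deletions3 : seq deletion :=
  [:: ([:: 0; 1; 2], 2, true); ([:: 1; 0; 2], 2, true);
      ([:: 1; 2; 0], 0, false); ([:: 2; 1; 0], 0, false);
      ([:: 0; 1; 3; 2], 3, false); ([:: 0; 3; 1; 2], 1, true);
      ([:: 1; 0; 3; 2], 3, false); ([:: 1; 3; 0; 2], 0, false)].

Lemma classical_words3_certified :
  certified (map classical classical_words3) classical_deletions3.
Proof. by vm_compute. Qed.

Theorem corollary2 :
  let C := Av_mixed
    [:: [:: 2; 3; 4; 1]; [:: 3; 4; 1; 2]; [:: 3; 4; 2; 1];
        [:: 4; 1; 2; 3]; [:: 4; 2; 3; 1]; [:: 4; 3; 1; 2]]
    [:: [:: (4, false); (1, true); (3, false); (5, false); (2, false)];
        [:: (4, false); (1, false); (3, false); (5, true); (2, false)]] in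
  [/\ wilf_equivalent C (Av
        [:: [:: 2; 4; 3; 1]; [:: 3; 4; 1; 2]; [:: 3; 4; 2; 1]; [:: 4; 1; 2; 3];
            [:: 4; 2; 1; 3]; [:: 4; 2; 3; 1]; [:: 4; 3; 1; 2]; [:: 4; 3; 2; 1]]),
      wilf_equivalent C (Av
        [:: [:: 2; 4; 1; 3]; [:: 3; 4; 1; 2]; [:: 3; 4; 2; 1]; [:: 4; 1; 2; 3];
            [:: 4; 1; 3; 2]; [:: 4; 2; 1; 3]; [:: 4; 3; 1; 2]; [:: 4; 3; 2; 1]])
    & wilf_equivalent C (Av
        [:: [:: 1; 3; 4; 2]; [:: 1; 4; 3; 2]; [:: 3; 1; 4; 2]; [:: 3; 4; 1; 2];
            [:: 4; 1; 2; 3]; [:: 4; 1; 3; 2]; [:: 4; 2; 1; 3]; [:: 4; 3; 1; 2]])].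
Proof.
split.
- exact: (certified_wilf_equivalent barred_class_words_certified
    classical_words1_certified).
- exact: (certified_wilf_equivalent barred_class_words_certified
    classical_words2_certified).
- exact: (certified_wilf_equivalent barred_class_words_certified
    classical_words3_certified).
Qed.
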